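(* For each of the four possibilities (the noncentered operator $\mathcal M_{\mathfrak X}$ does / does not possess the dichotomy property, and the centered operator $\mathcal M^{\rm c}_{\mathfrak X}$ does / does not possess the dichotomy property) there exists a nondoubling metric measure space $\mathfrak X$ realizing it.
   Context: Metric measure space $(X,\rho,\mu)$: nonempty set, metric, nonnegative Borel measure with $\mu(B)\in(0,\infty)$ for each open ball $B$; doubling means $\mu(B(x,2s))\le C\mu(B(x,s))$ uniformly. $L^1_{\rm loc}(\mu)$: functions integrable on every open ball. $\mathcal M^{\rm c}f(x)=\sup_{s>0}\mu(B(x,s))^{-1}\int_{B(x,s)}|f|d\mu$, $\mathcal Mf(x)=\sup_{B\ni x}\mu(B)^{-1}\int_B|f|d\mu$. $\mathcal M$ possesses the dichotomy property if for every $f\in L^1_{\rm loc}(\mu)$ either $\mu(\{\mathcal Mf=\infty\})=0$ or $\{\mathcal Mf=\infty\}=X$; analogously for $\mathcal M^{\rm c}$. *)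

(* Defs.v *)
From HB Require Import structures.
From mathcomp Require Import all_boot all_order all_algebra.
From mathcomp Require Import all_classical all_reals all_analysis.
From mathcomp Require Import Rstruct Rstruct_topology.
From Stdlib Require Import Rdefinitions.
Set Implicit Arguments. Unset Strict Implicit. Unset Printing Implicit Defensive.
Import Order.TTheory GRing.Theory Num.Theory.
Local Open Scope classical_set_scope.
Local Open Scope ring_scope.

Notation Rreal := Rdefinitions.R.

Section MMS.
Variable X : pointedType.
Variable rho : X -> X -> Rreal.

Definition is_metric : Prop :=
  [/\ forall x y, 0 <= rho x y,
      forall x y, rho x y = 0 <-> x = y,
      forall x y, rho x y = rho y x &
      forall x y z, rho x z <= rho x y + rho y z].

Definition rball (x : X) (s : Rreal) : set X := [set y | rho x y < s].

Definition ropen : set (set X) :=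
  [set U | forall x, U x -> exists2 s : Rreal, 0 < s & rball x s `<=` U].

Definition metric_borel := g_sigma_algebraType ropen.

Variable mu : {measure set metric_borel -> \bar Rreal}.

Definition is_mms : Prop :=
  is_metric /\ forall (x : X) (s : Rreal), 0 < s ->
     (0 < mu (rball x s : set metric_borel))%E /\ (mu (rball x s : set metric_borel) < +oo)%E.

Definition doubling : Prop :=
  exists C : Rreal, forall (x : X) (s : Rreal), 0 < s ->
    (mu (rball x (2 * s) : set metric_borel) <= C%:E * mu (rball x s : set metric_borel))%E.

Definition L1loc (f : X -> Rreal) : Prop :=
  forall (x : X) (s : Rreal), 0 < s ->
    mu.-integrable (rball x s : set metric_borel) (fun y : metric_borel => (f y)%:E).

Definition ball_avg (f : X -> Rreal) (y : X) (s : Rreal) : \bar Rreal :=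
  ((fine (mu (rball y s : set metric_borel)))^-1)%:E *
    (\int[mu]_(z in (rball y s : set metric_borel)) `|f z|%:E)%E.

Definition Mc (f : X -> Rreal) (x : X) : \bar Rreal :=
  ereal_sup [set ball_avg f x s | s in [set s : Rreal | 0 < s]].

Definition Mnc (f : X -> Rreal) (x : X) : \bar Rreal :=
  ereal_sup [set ball_avg f p.1 p.2 |
              p in [set p : X * Rreal | 0 < p.2 /\ rho p.1 x < p.2]].

Definition dichotomy (M : (X -> Rreal) -> X -> \bar Rreal) : Prop :=
  forall f : X -> Rreal, L1loc f ->
    mu.-negligible ([set x | M f x = +oo%E] : set metric_borel)
    \/ [set x | M f x = +oo%E] = setT.

End MMS.

(* Main.v *)
(* The space consists of light points y_n = (n, false) of mass 1 and heavy
   points z_n = (n, true) of mass n!^2, at depth n and n + 1 below the origin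
   y_0.  For a = b = true it is a star: distances between distinct points are
   sums of depths.  Large balls are then balls around the origin up to their
   center, so they can be made to contain any given point at the cost of a
   bounded mass, while every ball has mass at least 1.

   For a = false, y_(n+1) and z_n are moved to distance n + 2 from each other.
   Small balls around y_(n+1) contain only y_(n+1) and y_0, but any ball
   containing z_0 and y_(n+1) contains z_n; so spikes of height n!^2 at y_(n+1)
   have infinite noncentered maximal function at y_0, and at most 1 at z_0.

   For b = false, z_0 becomes a second hub, at distance n from z_n.  Balls
   around y_0 reach y_n before z_n while balls around z_0 reach z_n first, so
   spikes of height n!^2 at y_n separate y_0 from z_0 for the centered one. *)

Require Import Defs.
From mathcomp Require Import all_boot all_order all_algebra.
From mathcomp Require Import all_classical all_reals all_analysis.
From mathcomp Require Import Rstruct Rstruct_topology.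
From mathcomp Require Import measurable_realfun.
From mathcomp Require Import zify lra.

Set Implicit Arguments.
Unset Strict Implicit.
Unset Printing Implicit Defensive.
Import Order.TTheory GRing.Theory Num.Theory.

Local Open Scope classical_set_scope.
Local Open Scope ring_scope.

(** * Points where a maximal function is infinite *)

Lemma ereal_sup_eqy (S : set (\bar Rreal)) :
  ereal_sup S = +oo%E <->
  forall C : Rreal, 0 < C -> exists2 y, S y & (C%:E < y)%E.
Proof.
split=> [Soo C _|SC]; first by apply: ereal_sup_gt; rewrite Soo ltry.
apply/eqyP => C /SC[y Sy Cy]; apply: (le_trans (ltW Cy)).
exact: ereal_sup_ubound.
Qed.

Section maximal_functions.
Variables (X : pointedType) (rho : X -> X -> Rreal).
Variable mu : {measure set (metric_borel rho) -> \bar Rreal}.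
Hypothesis mms : is_mms mu.
Local Notation ball x s := (rball rho x s : set (metric_borel rho)).

Lemma lt_ball_avg f x s (C : Rreal) : 0 < s ->
  (C%:E < ball_avg mu f x s)%E =
  (C%:E * mu (ball x s) < \int[mu]_(z in ball x s) `|f z|%:E)%E.
Proof.
move=> s0; have [m0 moo] := mms.2 x s s0; rewrite /ball_avg.
have mfin : mu (ball x s) \is a fin_num by rewrite ge0_fin_numE.
have fm0 : 0 < fine (mu (ball x s)) by rewrite fine_gt0 // m0.
by rewrite lte_pdivlMl // fineK // [X in (X < _)%E]muleC.
Qed.

Lemma Mc_eqy f x : Mc mu f x = +oo%E <->
  forall C : Rreal, 0 < C -> exists2 s, 0 < s &
    (C%:E * mu (ball x s) < \int[mu]_(z in ball x s) `|f z|%:E)%E.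
Proof.
rewrite /Mc ereal_sup_eqy; split=> H C /H.
  by move=> [_ [s /= s0 <-]]; rewrite lt_ball_avg //; exists s.
move=> [s s0 Cs]; exists (ball_avg mu f x s); first by exists s.
by rewrite lt_ball_avg.
Qed.

Lemma Mnc_eqy f x : Mnc mu f x = +oo%E <->
  forall C : Rreal, 0 < C -> exists p s, rho p x < s /\
    (C%:E * mu (ball p s) < \int[mu]_(z in ball p s) `|f z|%:E)%E.
Proof.
rewrite /Mnc ereal_sup_eqy; split=> H C /H.
  by move=> [_ [[p s] /= [s0 ps] <-]]; rewrite lt_ball_avg //; exists p, s.
move=> [p [s [ps Cs]]]; have s0 : 0 < s.
  by case: mms => -[rho0 _ _ _] _; exact: le_lt_trans ps.
exists (ball_avg mu f p s); first by exists (p, s).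
by rewrite lt_ball_avg.
Qed.

(** When every point has positive mass, only the empty set is negligible, so the dichotomy means
    that an infinite value at one point spreads to all points. *)
Lemma dichotomyP (M : (X -> Rreal) -> X -> \bar Rreal) :
  (forall A : set (metric_borel rho), measurable A) ->
  (forall x, 0 < mu [set x])%E ->
  dichotomy mu M <->
  forall f, L1loc mu f -> forall x y, M f x = +oo%E -> M f y = +oo%E.
Proof.
move=> mA mx; split=> [dM f fL x y fx|dM f fL].
  have [[N [_ N0 NM]]|MT] := dM f fL.
    have : (mu [set x] <= mu N)%E.
      by apply: le_measure; rewrite ?inE // => _ ->; exact: NM.
    by rewrite N0 leNgt mx.
  by have : [set x | M f x = +oo%E] y by rewrite MT.
have [[x fx]|noo] := pselect (exists x, M f x = +oo%E).
  by right; rewrite -subTset => y _; exact: dM fx.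
left; suff -> : [set x | M f x = +oo%E] = set0 by exact: negligible_set0.
by rewrite -subset0 => x fx; apply: noo; exists x.
Qed.

End maximal_functions.

(** * The distances and which points a ball must contain *)

Definition depth (p : nat * bool) : nat := (p.1 + p.2)%N.

Definition dist (a b : bool) (p q : nat * bool) : nat :=
  if p == q then 0%N
  else if [&& ~~ a, p.2 != q.2 & depth p == depth q] then (depth p).+1
  else if [&& ~~ b, p.2 & q.2] then (p.1 + q.1)%N
  else (depth p + depth q)%N.

Ltac dist_lia :=
  rewrite /dist /depth ?xpair_eqE /= ?eqxx ?andbT ?andbF /=;
  repeat case: ifP => ? /=; lia.

Lemma dist_triangle a b p q r :
  (dist a b p r <= dist a b p q + dist a b q r)%N.
Proof.
by case: p q r a b => [m [|]] [n [|]] [k [|]] [|] [|]; dist_lia.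
Qed.

Lemma distC a b p q : dist a b p q = dist a b q p.
Proof. by case: p q a b => [m [|]] [n [|]] [|] [|]; dist_lia. Qed.

Lemma dist_eq0 a b p q : (dist a b p q == 0%N) = (p == q).
Proof. by case: p q a b => [m [|]] [n [|]] [|] [|]; dist_lia. Qed.

Lemma distxx a b p : dist a b p p = 0%N.
Proof. by apply/eqP; rewrite dist_eq0. Qed.

Lemma depth_le_dist a b p q : (depth q <= dist a b p q + depth p)%N.
Proof. by case: p q a b => [m [|]] [n [|]] [|] [|]; dist_lia. Qed.

Lemma dist_le_depth a b p q : (dist a b p q <= depth p + depth q)%N.
Proof. by case: p q a b => [m [|]] [n [|]] [|] [|]; dist_lia. Qed.

(** The only shortcut left joins two heavy points through [(0, true)]; it saves one unit of depth at
    each end. *)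
Lemma dist_nomates b p q :
  p = q \/ (depth p + depth q <= dist true b p q + 2)%N.
Proof.
have [->|pq] := eqVneq p q; [by left|right; move: pq].
by case: p q b => [m [|]] [n [|]] [|]; dist_lia.
Qed.

Lemma dist_onehub a p q : dist a true p q = (depth p + depth q)%N \/
  (dist a true p q <= depth p + 1)%N /\ (depth q = depth p).
Proof. by case: p q a => [m [|]] [n [|]] [|]; dist_lia. Qed.

(** If [p] is neither [(n, true)] nor its mate [(n.+1, false)], its distance to the mate is the full
    sum of depths. If [p] is the mate and [0 < n], then [(0, true)] and [(n, true)] are both at
    distance [n.+2]. *)
Lemma dist_mate b p n : (dist false b p (n, true) <=
  maxn (dist false b p (0, true)) (dist false b p (n.+1, false)))%N.
Proof.
rewrite leq_max; case: p b => [m [|]] [|]; dist_lia.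
Qed.

Lemma dist_hub n a :
  (dist a false (0, true) (n, true) <= dist a false (0, true) (n, false))%N.
Proof. by case: a; dist_lia. Qed.

Lemma dist_origin a b p : dist a b (0, false) p = depth p.
Proof. by case: p a b => [m [|]] [|] [|]; dist_lia. Qed.

(** * Growth of the weights *)

Definition weight (n : nat) : nat := (n`! ^ 2)%N.

Lemma weight_gt0 n : (0 < weight n)%N.
Proof. by rewrite expn_gt0 fact_gt0. Qed.

Lemma leq_weight m n : (m <= n)%N -> (weight m <= weight n)%N.
Proof. by move=> mn; rewrite leq_exp2r // leq_fact. Qed.

Lemma weight_unbounded (C : Rreal) : exists n, C < (weight n)%:R.
Proof.
exists (Num.truncn C).+1; apply: lt_le_trans (truncnS_gt C) _.
by rewrite ler_nat (leq_trans (fact_geq _)) // /weight expnS expn1 leq_pmulr // fact_gt0.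
Qed.

(** The ratio [n.+1 ^ 2] of consecutive weights outgrows the factor [n.+2] lost when a sum of masses
    is bounded by its number of terms times the largest; this is why the factorial is squared. *)
Lemma weight_growth (C : Rreal) n : 0 < C -> 4 * C < n%:R ->
  C * (n.+2 * (1 + weight n))%:R < (weight n.+1)%:R.
Proof.
move=> C0; have -> : weight n.+1 = (n.+1 * n.+1 * weight n)%N.
  by rewrite /weight factS expnMn.
have := weight_gt0 n; rewrite -(ler_nat Rreal); move: (weight n) => w w1.
rewrite -[n.+2]addn2 -[n.+1]addn1 !natrM !natrD; move: w1; have : 0 <= n%:R :> Rreal by [].
move: (n%:R : Rreal) (w%:R : Rreal) => x {}w x0 w1 Cx.
have : C * ((x + 2) * (1 + w)) <= C * ((x + 2) * (2 * w)).
  by apply: ler_wpM2l; [lra|apply: ler_wpM2l; lra].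
have : (4 * C) * ((x + 2) * (2 * w)) < x * ((x + 2) * (2 * w)).
  by rewrite ltr_pM2r //; nra.
have : 0 <= x * x * w by rewrite !mulr_ge0; lra.
have : 0 <= x * w by rewrite !mulr_ge0; lra.
lra.
Qed.

(** The radius [n + 3/2] separates the integer distances [n.+1] and [n.+2]. *)
Lemma radius_gt0 n : 0 < n%:R + 3/2 :> Rreal.
Proof. by rewrite ltr_wpDl //; lra. Qed.

(** * The measure, and integrals as sums over indices *)

Section space.
Variables a b : bool.

Definition rho (p q : nat * bool) : Rreal := (dist a b p q)%:R.

Local Notation T := (metric_borel rho).
Local Notation ball x s := (rball rho x s : set T).

Definition pair_mass (n : nat) : {measure set T -> \bar Rreal} :=
  measure_add (dirac ((n, false) : T))
    (mscale (NngNum (ler0n Rreal (weight n))) (dirac ((n, true) : T))).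

Definition mu : {measure set T -> \bar Rreal} := mseries pair_mass 0.

Lemma rho_metric : is_metric rho.
Proof.
split=> [x y|x y|x y|x y z]; rewrite /rho ?ler0n //.
- split=> [/eqP|->]; first by rewrite pnatr_eq0 dist_eq0 => /eqP.
  by rewrite distxx.
- by rewrite distC.
- by rewrite -natrD ler_nat dist_triangle.
Qed.

(** Distances are integers, so balls of radius 1 are single points and every set is open. *)
Lemma measurable_all (A : set T) : measurable A.
Proof.
apply: sub_sigma_algebra => x Ax; exists 1 => // y.
by rewrite /rball /rho /= ltrn1 ltnS leqn0 dist_eq0 => /eqP <-.
Qed.

Lemma measurable_fun_all d (S : measurableType d) (A : set T) (f : T -> S) :
  measurable_fun A f.
Proof. by move=> _ B _; exact: measurable_all. Qed.

Lemma integral_mu (A : set T) (g : T -> Rreal) : (forall x, 0 <= g x) ->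
  (\int[mu]_(x in A) (g x)%:E = \sum_(n <oo)
     (((n, false) \in A)%:R * g (n, false) +
      (weight n)%:R * (((n, true) \in A)%:R * g (n, true)))%:E)%E.
Proof.
move=> g0; rewrite ge0_integral_measure_series //; last first.
- exact: measurable_fun_all.
- by move=> x _; rewrite lee_fin.
- exact: measurable_all.
apply: eq_eseriesr => n _; rewrite ge0_integral_measure_add //; first last.
- exact: measurable_fun_all.
- by move=> x _; rewrite lee_fin.
- exact: measurable_all.
rewrite ge0_integral_mscale //; first last.
- by move=> x _; rewrite lee_fin.
- exact: measurable_fun_all.
- exact: measurable_all.
rewrite !integral_dirac; try exact: measurable_all; try exact: measurable_fun_all.
by rewrite !diracE.
Qed.

Lemma muE (A : set T) : (mu A = \int[mu]_(x in A) 1%:E)%E.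
Proof. by rewrite integral_cst ?mul1e //; exact: measurable_all. Qed.

Lemma le_mu (A B : set T) : A `<=` B -> (mu A <= mu B)%E.
Proof. by apply: le_measure; rewrite inE; exact: measurable_all. Qed.

Lemma le_integral_mu (A B : set T) (f : T -> Rreal) : A `<=` B ->
  (\int[mu]_(x in A) `|f x|%:E <= \int[mu]_(x in B) `|f x|%:E)%E.
Proof.
apply: ge0_subset_integral; try exact: measurable_all.
- exact: measurable_fun_all.
- by move=> x _; rewrite lee_fin.
Qed.

Lemma integral_depth (A : set T) (g : T -> Rreal) N : (forall x, 0 <= g x) ->
  (forall x, A x -> (depth x < N)%N) ->
  (\int[mu]_(x in A) (g x)%:E = \sum_(0 <= n < N)
     (((n, false) \in A)%:R * g (n, false) +
      (weight n)%:R * (((n, true) \in A)%:R * g (n, true)))%:E)%E.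
Proof.
move=> g0 AN; rewrite integral_mu // (nneseries_split 0 N); last first.
  by move=> k _; rewrite lee_fin addr_ge0 ?mulr_ge0.
rewrite add0n [X in (_ + X)%E](_ : _ = 0%E) ?adde0 //.
apply: eseries0 => n Nn _; rewrite !memNset ?mul0r ?mulr0 ?addr0 //.
  by move=> /AN; rewrite /depth /=; lia.
by move=> /AN; rewrite /depth /=; lia.
Qed.

Lemma integral_atom (A : set T) (f : T -> Rreal) n : A (n, false) ->
  (`|f (n, false)|%:E <= \int[mu]_(x in A) `|f x|%:E)%E.
Proof.
move=> An; rewrite integral_mu //.
rewrite (@nneseriesD1 _ _ n); [|by move=> k _; rewrite lee_fin addr_ge0 ?mulr_ge0|by []].
rewrite mem_set // mul1r; apply: le_trans (leeDl _ _).
  by rewrite lee_fin lerDl !mulr_ge0.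
by apply: nneseries_ge0 => k _; rewrite lee_fin addr_ge0 ?mulr_ge0.
Qed.

Lemma mu_set1 n i : mu [set (n, i)] = (if i then (weight n)%:R else 1)%:E.
Proof.
rewrite muE integral_mu //.
rewrite (@nneseriesD1 _ _ n); [|by move=> k _; rewrite lee_fin addr_ge0 ?mulr_ge0|by []].
rewrite eseries0 => [|k _ /= kn]; rewrite !in_set1 !xpair_eqE.
  by rewrite eqxx adde0; case: i => /=; congr EFin; lra.
by rewrite (negbTE kn) !mul0r mulr0 addr0.
Qed.

Lemma mu_ge1 (A : set T) x : A x -> (1 <= mu A)%E.
Proof.
case: x => n i Ax; have : (mu [set (n, i)] <= mu A)%E by apply: le_mu => _ ->.
apply: le_trans; rewrite mu_set1 lee_fin.
by case: i {Ax} => //; rewrite ler1n weight_gt0.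
Qed.

Lemma integral_depth_fin (A : set T) (g : T -> Rreal) N :
  (forall x, 0 <= g x) -> (forall x, A x -> (depth x < N)%N) ->
  (\int[mu]_(x in A) (g x)%:E < +oo)%E.
Proof. by move=> g0 AN; rewrite (integral_depth g0 AN) sumEFin ltry. Qed.

(** Such depths allow light points up to index [n.+1] but heavy ones only up to [n], so each of the
    [n.+2] indices contributes at most [1 + weight n]. *)
Lemma mu_depth_le (A : set T) n : (forall x, A x -> (depth x <= n.+1)%N) ->
  (mu A <= (n.+2 * (1 + weight n))%:R%:E)%E.
Proof.
move=> An; rewrite muE (@integral_depth _ _ n.+2) // sumEFin lee_fin.
rewrite mulnC natrM mulr_natr -[in leRHS](subn0 n.+2) -[in leRHS]sumr_const_nat.
apply: ler_sum_nat => k /andP[_ kn]; rewrite !mulr1 natrD.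
apply: lerD; first by case: (_ \in A).
case: (boolP (_ \in A)) => [|_]; last by rewrite mulr0.
rewrite inE mulr1 ler_nat => /An; rewrite /depth /= => kn1.
by apply: leq_weight; lia.
Qed.

Lemma ball_depth p s : exists N, forall q, ball p s q -> (depth q < N)%N.
Proof.
exists (Num.truncn s + depth p).+1 => q; rewrite /rball /rho /= => pqs.
have := depth_le_dist a b p q; suff : (dist a b p q <= Num.truncn s)%N by lia.
by rewrite truncn_ge_nat ?ltW // (le_lt_trans _ pqs).
Qed.

Lemma mu_mms : is_mms mu.
Proof.
split=> [|x s s0]; first exact: rho_metric.
split.
  apply: (@lt_le_trans _ _ 1%E); first exact: lte01.
  by apply: (@mu_ge1 _ x); rewrite /rball /rho /= distxx.
have [N xN] := ball_depth x s.
by rewrite muE; apply: integral_depth_fin xN.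
Qed.

(** Balls have bounded depth, hence finitely many points. *)
Lemma L1loc_mu f : L1loc mu f.
Proof.
move=> x s _; apply/integrableP; split; first exact: measurable_fun_all.
have [N xN] := ball_depth x s.
by under eq_integral do rewrite abse_EFin; apply: integral_depth_fin xN.
Qed.

Lemma dichotomy_muP (M : (nat * bool -> Rreal) -> nat * bool -> \bar Rreal) :
  dichotomy mu M <-> forall f x y, M f x = +oo%E -> M f y = +oo%E.
Proof.
rewrite dichotomyP; last 2 first.
- exact: measurable_all.
- by move=> x; apply: lt_le_trans (mu_ge1 (erefl x : [set x] x)); exact: lte01.
by split=> H f; [apply: H; exact: L1loc_mu|move=> _; exact: H].
Qed.

(** * Light balls and the failure of doubling *)

Lemma ball_light n q :
  ball (n.+1, false) (n%:R + 3/2) q -> q = (0%N, false) \/ q = (n.+1, false).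
Proof.
have [|q0] := leqP (n.+2) (dist a b (n.+1, false) q).
  by rewrite /rball /rho /= -(ler_nat Rreal) -addn2 natrD => ? ?; exfalso; lra.
move=> _; have [->|] := eqVneq q (n.+1, false); first by right.
have [->|] := eqVneq q (0%N, false); [by left|move: q0].
by case: q a b => [k [|]] [|] [|]; rewrite xpair_eqE; dist_lia.
Qed.

Lemma mu_ball_light n : (mu (ball (n.+1, false) (n%:R + 3/2)%R) <= 2%:E)%E.
Proof.
have -> : (2%:E = mu [set (0%N, false)] + mu [set (n.+1, false)])%E.
  by rewrite !mu_set1.
apply: (le_trans _ (measureU2 _ _ _)); try exact: measurable_all.
by apply: le_mu => q /ball_light.
Qed.

(** Doubling the radius [n + 3/2] around [(n.+1, false)] brings in [(n, true)], raising the mass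
    from at most 2 to at least [weight n]. *)
Lemma mu_nondoubling : ~ doubling mu.
Proof.
move=> [C muC]; have [n Cn] := weight_unbounded (`|C| * 2).
have s0 := radius_gt0 n.
have := muC (n.+1, false) _ s0; apply/negP; rewrite -ltNge.
apply: (@le_lt_trans _ _ (`|C| * 2)%:E); last first.
  apply: (@lt_le_trans _ _ (mu [set (n, true)])); first by rewrite mu_set1 lte_fin.
  apply: le_mu => _ ->; rewrite /rball /rho /=.
  have : (dist a b (n.+1, false) (n, true) <= 2 * n + 2)%N.
    apply: leq_trans (dist_le_depth _ _ _ _) _; rewrite /depth /=; lia.
  (* The 2 of [doubling] is a constant of the Stdlib reals. *)
  by rewrite -(ler_nat Rreal) natrD natrM RmultE (_ : Rdefinitions.IZR _ = 2) //; lra.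
rewrite EFinM; apply: (@le_trans _ _ (`|C|%:E * mu (ball (n.+1, false) (n%:R + 3/2)%R))%E).
  by rewrite lee_wpmul2r // lee_fin ler_norm.
by rewrite lee_wpmul2l // ?lee_fin // mu_ball_light.
Qed.

(** * Cases where the dichotomy holds *)

Lemma dichotomy_Mnc : a -> dichotomy mu (Mnc mu).
Proof.
move=> a1; apply/dichotomy_muP => f x y /(Mnc_eqy mu_mms) fx.
apply/(Mnc_eqy mu_mms) => C C0.
(* Enlarging a ball around [p] until it contains [y] adds only points of depth at most
   [depth y + 2], by [dist_nomates]; this bound does not depend on [p]. *)
pose N := (depth y).+3; pose low : set T := [set q | (depth q < N)%N].
have lowfin : mu low \is a fin_num.
  rewrite ge0_fin_numE // muE.
  by apply: (@integral_depth_fin _ _ N).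
pose K := fine (mu low).
have K0 : 0 <= K by exact: fine_ge0.
(* The ball has mass at least 1, so adding [low] multiplies its mass by at most [1 + K]. *)
have [p [s [pxs fps]]] := fx (C * (1 + K)) (mulr_gt0 C0 (ltr_wpDr K0 ltr01)).
pose t := Num.max s (depth p + depth y).+1%:R.
exists p, t; split.
  rewrite lt_max /rho [X in _ || X]ltr_nat ltnS dist_le_depth orbT //.
have B1 : (1 <= mu (ball p s))%E by exact: (mu_ge1 pxs).
have sub : ball p t `<=` ball p s `|` low.
  move=> q; rewrite /rball /rho /= lt_max => /orP[|]; first by left.
  rewrite ltr_nat => pq.
  have [<-|] := dist_nomates b p q; last by move: pq; rewrite a1 /low /N /=; right; lia.
  left; apply: le_lt_trans pxs.
  by rewrite distxx.
have s0 : 0 < s by apply: le_lt_trans pxs; rewrite /rho.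
have [_ Bfin] := mu_mms.2 p s s0.
have muB : (mu (ball p t) <= (1 + K)%:E * mu (ball p s))%E.
  apply: (le_trans (le_mu sub)).
  apply: (@le_trans _ _ (mu (ball p s) + mu low)%E).
    by apply: measureU2; exact: measurable_all.
  move: B1 Bfin; rewrite -(fineK lowfin) -/K.
  case: (mu (ball p s)) => // r; rewrite !lee_fin => r1 _; nra.
apply: (@le_lt_trans _ _ ((C * (1 + K))%:E * mu (ball p s))%E).
  rewrite EFinM -muleA lee_wpmul2l // lee_fin; exact: ltW.
apply: (lt_le_trans fps); apply: le_integral_mu => q.
by rewrite /rball /= /t lt_max => ->.
Qed.

Lemma dichotomy_Mc : b -> dichotomy mu (Mc mu).
Proof.
move=> b1; apply/dichotomy_muP => f x y /(Mc_eqy mu_mms) fx.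
apply/(Mc_eqy mu_mms) => C C0.
pose S := (2 * (depth x + depth y + 1))%N.
have [N xN] := ball_depth x S%:R.
pose I := fine (\int[mu]_(z in ball x S%:R) `|f z|%:E)%E.
have Ifin : (\int[mu]_(z in ball x S%:R) `|f z|%:E)%E = I%:E.
  rewrite fineK // ge0_fin_numE; first exact: integral_depth_fin xN.
  by apply: integral_ge0 => z _; rewrite lee_fin.
have I0 : 0 <= I.
  by apply: fine_ge0; apply: integral_ge0 => z _; rewrite lee_fin.
(* Averages over radii up to [S] are at most [I], so exceeding [C + I] forces [S < s]. *)
have [s s0 fxs] := fx (C + I) (ltr_wpDr I0 C0).
have [_ Bfin] := mu_mms.2 x s s0.
have B1 : (1 <= mu (ball x s))%E.
  by apply: (@mu_ge1 _ x); rewrite /rball /rho /= distxx.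
have Ss : S%:R < s.
  rewrite ltNge; apply/negP => sS; move: fxs; apply/negP; rewrite -leNgt.
  apply: (@le_trans _ _ I%:E).
    rewrite -Ifin; apply: le_integral_mu => q; rewrite /rball /= => xq.
    exact: lt_le_trans xq sS.
  move: B1 Bfin; case: (mu (ball x s)) => // r; rewrite !lee_fin => r1 _; nra.
have Sxy : S%:R = 2 * ((depth x)%:R + (depth y)%:R + 1) :> Rreal.
  by rewrite /S natrM !natrD.
have dx0 : 0 <= (depth x)%:R :> Rreal by [].
have dy0 : 0 <= (depth y)%:R :> Rreal by [].
pose t := s - (depth x)%:R + (depth y)%:R.
have t0 : 0 < t by rewrite /t; lra.
(* Large balls are balls around the origin. By [dist_onehub] the exceptional points [q] have the
   depth of [z], and this [r] puts them in both sets. *)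
have hub z r : 2 * (depth z)%:R + 1 < r ->
    ball z r = [set q | (depth q)%:R < r - (depth z)%:R].
  move=> zr; have dz0 : 0 <= (depth z)%:R :> Rreal by [].
  apply/seteqP; split=> q; rewrite /rball /rho /= b1.
    have [->|[_ ->]] := dist_onehub a z q; first by rewrite natrD; lra.
    lra.
  have [->|[+ ->]] := dist_onehub a z q; first by rewrite natrD; lra.
  rewrite -(ler_nat Rreal) natrD; lra.
have xy : ball y t = ball x s.
  rewrite !hub; [|lra|rewrite /t; lra].
  by apply/seteqP; split => q /=; rewrite /t; lra.
exists t => //; rewrite xy; apply: le_lt_trans fxs.
move: B1 Bfin; case: (mu (ball x s)) => // r; rewrite !lee_fin => r1 _; nra.
Qed.

(** * Spikes, and the cases where the dichotomy fails *)

Definition spike (k : nat) (p : nat * bool) : Rreal :=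
  if p.2 || (p.1 < k)%N then 0 else (weight (p.1 - k))%:R.

Lemma spike_ge0 k p : 0 <= spike k p.
Proof. by rewrite /spike; case: ifP. Qed.

Lemma integral_spike k (A : set T) :
  (\int[mu]_(x in A) `|spike k x|%:E =
   \sum_(n <oo) (((n + k, false)%N \in A)%:R * (weight n)%:R)%:E)%E.
Proof.
under eq_integral do rewrite ger0_norm ?spike_ge0 //.
rewrite (integral_mu _ (spike_ge0 k)).
under eq_eseriesr do rewrite {2}/spike /= !mulr0 addr0.
rewrite (nneseries_split 0 k); last first.
  by move=> n _; rewrite lee_fin mulr_ge0 ?spike_ge0.
rewrite add0n big_nat_cond big1 ?add0e; last first.
  by move=> n /andP[/andP[_ nk] _]; rewrite /spike /= nk mulr0.
rewrite -nneseries_addn; last by move=> n; rewrite lee_fin mulr_ge0 ?spike_ge0.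
by apply: eq_eseriesr => n _; rewrite /spike /= ltnNge leq_addl /= addnK.
Qed.

(** The spike at the unit mass [(n + k, false)] contributes [weight n], exactly the mass of
    [(n, true)]. Shift 1 pairs mates, shift 0 pairs equal indices. *)
Lemma integral_spike_le k (A : set T) :
  (forall n, A (n + k, false)%N -> A (n, true)) ->
  (\int[mu]_(x in A) `|spike k x|%:E <= mu A)%E.
Proof.
move=> Ak; rewrite integral_spike muE integral_mu //.
apply: lee_nneseries => [n _ _|n _]; first by rewrite lee_fin mulr_ge0.
rewrite lee_fin !mulr1; case: (boolP (_ \in A)) => [|_].
  by rewrite inE => /Ak An; rewrite (mem_set An) mul1r mulr1 lerDr.
by rewrite mul0r addr_ge0 ?mulr_ge0.
Qed.

Lemma not_dichotomy_Mnc : ~~ a -> ~ dichotomy mu (Mnc mu).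
Proof.
move=> /negbTE a0 /dichotomy_muP/(_ (spike 1) (0%N, false) (0%N, true)) H.
have /H/(Mnc_eqy mu_mms)/(_ 1 ltr01)[p [s [ps]]] : Mnc mu (spike 1) (0%N, false) = +oo%E.
  apply/(Mnc_eqy mu_mms) => C C0; have [n Cn] := weight_unbounded (C * 2).
  exists (n.+1, false), (n%:R + 3/2); split.
    by rewrite /rho distC dist_origin /depth /= addn0 -addn1 natrD; lra.
  apply: (@le_lt_trans _ _ (C * 2)%:E).
    by rewrite EFinM lee_wpmul2l ?mu_ball_light // lee_fin ltW.
  apply: (@lt_le_trans _ _ `|spike 1 (n.+1, false)|%:E).
    by rewrite lte_fin ger0_norm ?spike_ge0 // /spike /= subn1.
  apply: integral_atom; rewrite /rball /rho /=.
  by rewrite distxx radius_gt0.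
(* Any ball containing [(0, true)] has average at most 1: with [(n.+1, false)] it contains
   [(n, true)], by [dist_mate]. *)
apply/negP; rewrite -leNgt mul1e; apply: integral_spike_le => n.
rewrite addn1; move: ps; rewrite /rball /rho /= a0 => ps pn.
apply: (@le_lt_trans _ _ (maxn (dist false b p (0%N, true)) (dist false b p (n.+1, false)))%:R).
  by rewrite ler_nat dist_mate.
by rewrite natr_max // gt_max ps.
Qed.

Lemma not_dichotomy_Mc : ~~ b -> ~ dichotomy mu (Mc mu).
Proof.
move=> /negbTE b0 /dichotomy_muP/(_ (spike 0) (0%N, false) (0%N, true)) H.
have /H/(Mc_eqy mu_mms)/(_ 1 ltr01)[s s0] : Mc mu (spike 0) (0%N, false) = +oo%E.
  apply/(Mc_eqy mu_mms) => C C0; have [n Cn] : exists n : nat, 4 * C < n%:R.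
    by exists (Num.truncn (4 * C)).+1; exact: truncnS_gt.
  (* This ball around the origin reaches the spike of height [weight n.+1] at [(n.+1, false)], but
     not [(n.+1, true)], at depth [n.+2]. *)
  exists (n%:R + 3/2); first exact: radius_gt0.
  apply: (@le_lt_trans _ _ (C * (n.+2 * (1 + weight n))%:R)%:E).
    rewrite EFinM lee_wpmul2l //; first by rewrite lee_fin ltW.
    apply: mu_depth_le => q.
    rewrite /rball /rho /= dist_origin -ltnS -(ltr_nat Rreal) -addn2 natrD; lra.
  apply: (@lt_le_trans _ _ `|spike 0 (n.+1, false)|%:E).
    rewrite lte_fin ger0_norm ?spike_ge0 // /spike /= subn0.
    exact: weight_growth.
  apply: integral_atom; rewrite /rball /rho /= dist_origin /depth /= addn0 -addn1 natrD; lra.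
apply/negP; rewrite -leNgt mul1e; apply: integral_spike_le => n.
rewrite addn0 /rball /rho /= b0; apply: le_lt_trans.
by rewrite ler_nat dist_hub.
Qed.

End space.

Theorem theorem6p1p1 :
  forall a b : bool,
    exists (X : pointedType) (rho : X -> X -> Rreal)
           (mu : {measure set (metric_borel rho) -> \bar Rreal}),
      [/\ is_mms mu, ~ doubling mu,
          (dichotomy mu (Mnc mu) <-> a) &
          (dichotomy mu (Mc mu) <-> b)].
Proof.
move=> a b; exists (nat * bool)%type, (rho a b), (mu a b); split.
- exact: mu_mms.
- exact: mu_nondoubling.
- split; last exact: dichotomy_Mnc.
  by move=> H; apply: contraPT H; exact: not_dichotomy_Mnc.
- split; last exact: dichotomy_Mc.
  by move=> H; apply: contraPT H; exact: not_dichotomy_Mc.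
Qed.
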